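(* Let $U\subset\mathbb R^2$ be an open set with coordinates $(x,y)$, let $h:U\to\mathbb R$ be a positive smooth function, and let $g_\Sigma=h^2(dx^2+dy^2)$, $\omega_\Sigma=h^2\,dx\wedge dy$. Let $V\subset\mathbb R$ be open and $\alpha=\alpha(z)$ a smooth nowhere vanishing function on $V$; let $A$ be an antiderivative of $\alpha$ ($A'=\alpha$) and let $\beta$ be defined by $\beta\alpha=e^A$. Let $l_2=l_2(x,y)$, $n_2=n_2(x,y)$ be smooth functions on $U$ with $d(l_2\,dx+n_2\,dy)=\omega_\Sigma$. On $M=U\times V\times\mathbb R$ with coordinates $(x,y,z,t)$ put $\theta_3=\frac1\beta(dt-l_2\,dx-n_2\,dy)$, $\theta_4=dz$, and define the metric $$g(X,Y)=e^{-A}g_\Sigma(X,Y)+\theta_3(X)\theta_3(Y)+\theta_4(X)\theta_4(Y).$$ Then $(M,g)$ admits a K\''ahler structure $\bar J$ with K\''ahler form $\bar\Omega=e^{-A}\omega_\Sigma+\theta_4\wedge\theta_3$ and a Hermitian structure $J$ with K\''ahler form $\Omega=e^{-A}\omega_\Sigma+\theta_3\wedge\theta_4$. The Ricci tensor of $(M,g)$ is $J$-invariant and $J$ is locally conformally K\''ahler. The Lee form of $(M,g,J)$ is $\theta=-\alpha\theta_4$. The scalar curvature of $(M,g)$ is $$\tau=2\Big(-\frac{(\Delta\ln h)e^A}{h^2}-2\alpha^2+2\alpha'+\frac{\beta''}{\beta}-2\Big(\frac{\beta'}{\beta}\Big)^2\Big),$$ where $\Delta f=f_{xx}+f_{yy}$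 and primes denote derivatives with respect to $z$.
   Context: For an almost Hermitian structure $J$ orthogonal with respect to $g$, its K\''ahler form is $\Omega(X,Y)=g(JX,Y)$. A Hermitian structure is an integrable orthogonal almost complex structure. The Lee form $\theta$ of a Hermitian surface $(M,g,J)$ is defined by $d\Omega=2\theta\wedge\Omega$. The Ricci tensor $\rho$ is $J$-invariant if $\rho(JX,JY)=\rho(X,Y)$ for all $X,Y$. The scalar curvature is $\tau=\mathrm{tr}_g\rho$. *)

(* Defs.v *)
From HB Require Import structures.
From mathcomp Require Import all_boot all_order all_algebra.
From mathcomp Require Import all_classical all_reals all_analysis.
Set Implicit Arguments. Unset Strict Implicit. Unset Printing Implicit Defensive.
Import Order.TTheory GRing.Theory Num.Theory.
Import numFieldNormedType.Exports.
Local Open Scope classical_set_scope.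
Local Open Scope ring_scope.

Section CoordGeom.
Variable R : realType.

Definition ebasis n (i : 'I_n) : 'rV[R]_n := delta_mx 0 i.

Definition pd n (i : 'I_n) (f : 'rV[R]_n -> R) : 'rV[R]_n -> R :=
  fun p => derive f p (ebasis i).

Fixpoint Ck n (k : nat) (S : set 'rV[R]_n) (f : 'rV[R]_n -> R) : Prop :=
  (forall p, S p -> {for p, continuous f}) /\
  match k with
  | 0 => True
  | k'.+1 => forall i : 'I_n,
      (forall p, S p -> derivable f p (ebasis i)) /\ Ck k' S (pd i f)
  end.

Definition smooth_on n (S : set 'rV[R]_n) (f : 'rV[R]_n -> R) : Prop :=
  forall k, Ck k S f.

Definition smooth1_on (V : set R) (f : R -> R) : Prop :=
  forall k z, V z -> derivable (derive1n k f) z 1.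

Definition lap2 (f : 'rV[R]_2 -> R) (q : 'rV[R]_2) : R :=
  pd 0 (pd 0 f) q + pd 1 (pd 1 f) q.

(** ** Tensors in coordinates on an open subset of R^4.
   A (0,2)-tensor field or a 2-form is a matrix field F : 'rV_4 -> 'M_4 with
   F p i j = F(d_i, d_j).  Tangent vectors are row vectors; an endomorphism
   field J acts on the right: J X := X *m J p, so (J d_i) = row i of J p. *)

Definition comp (F : 'rV[R]_4 -> 'M[R]_4) (i j : 'I_4) : 'rV[R]_4 -> R :=
  fun p => F p i j.

Definition christ (G : 'rV[R]_4 -> 'M[R]_4) (p : 'rV[R]_4) (k i j : 'I_4) : R :=
  2^-1 * \sum_(l < 4) (invmx (G p)) k l *
    (pd i (comp G j l) p + pd j (comp G i l) p - pd l (comp G i j) p).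

(* Ricci tensor Ric(Y,Z) = tr (X |-> R(X,Y)Z), R(X,Y) = [nabla_X,nabla_Y] - nabla_[X,Y] *)
Definition ricci (G : 'rV[R]_4 -> 'M[R]_4) (p : 'rV[R]_4) : 'M[R]_4 :=
  \matrix_(j < 4, k < 4) \sum_(i < 4)
    (pd i (fun q => christ G q i j k) p - pd j (fun q => christ G q i i k) p
     + \sum_(m < 4) (christ G p m j k * christ G p i i m
                     - christ G p m i k * christ G p i j m)).

Definition scal (G : 'rV[R]_4 -> 'M[R]_4) (p : 'rV[R]_4) : R :=
  \sum_(j < 4) \sum_(k < 4) (invmx (G p)) j k * ricci G p j k.

Definition d2form (Om : 'rV[R]_4 -> 'M[R]_4) (p : 'rV[R]_4) (i j k : 'I_4) : R :=
  pd i (comp Om j k) p + pd j (comp Om k i) p + pd k (comp Om i j) p.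

Definition wedge11 (a b : 'rV[R]_4) : 'M[R]_4 := a^T *m b - b^T *m a.
Definition wedge12 (a : 'rV[R]_4) (B : 'M[R]_4) (i j k : 'I_4) : R :=
  a 0 i * B j k + a 0 j * B k i + a 0 k * B i j.

(* Kaehler form Om(X,Y) = g(JX,Y) *)
Definition kform (G J : 'rV[R]_4 -> 'M[R]_4) (p : 'rV[R]_4) : 'M[R]_4 :=
  J p *m G p.

(* Nijenhuis tensor N(d_i,d_j) = [Jd_i,Jd_j] - J[Jd_i,d_j] - J[d_i,Jd_j] - [d_i,d_j],
   a-th component *)
Definition nijenhuis (J : 'rV[R]_4 -> 'M[R]_4) (p : 'rV[R]_4) (i j a : 'I_4) : R :=
  \sum_(b < 4) (J p i b * pd b (comp J j a) p - J p j b * pd b (comp J i a) p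
                + pd j (comp J i b) p * J p b a - pd i (comp J j b) p * J p b a).

Definition orth_acs (S : set 'rV[R]_4) (G J : 'rV[R]_4 -> 'M[R]_4) : Prop :=
  (forall i j, smooth_on S (comp J i j)) /\
  (forall p, S p -> J p *m J p = - 1%:M /\ J p *m G p *m (J p)^T = G p).

Definition hermitian_str (S : set 'rV[R]_4) (G J : 'rV[R]_4 -> 'M[R]_4) : Prop :=
  orth_acs S G J /\ (forall p, S p -> forall i j a, nijenhuis J p i j a = 0).

Definition kaehler_str (S : set 'rV[R]_4) (G J : 'rV[R]_4 -> 'M[R]_4) : Prop :=
  hermitian_str S G J /\ (forall p, S p -> forall i j k, d2form (kform G J) p i j k = 0).

Definition lck (S : set 'rV[R]_4) (G J : 'rV[R]_4 -> 'M[R]_4) : Prop :=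
  forall p, S p -> exists W : set 'rV[R]_4,
    [/\ open W, W p, W `<=` S &
     exists f : 'rV[R]_4 -> R,
       smooth_on W f /\ kaehler_str W (fun q => expR (f q) *: G q) J].

Definition ricci_J_inv (S : set 'rV[R]_4) (G J : 'rV[R]_4 -> 'M[R]_4) : Prop :=
  forall p, S p -> J p *m ricci G p *m (J p)^T = ricci G p.

Definition o4 (k : nat) (H : (k < 4)%N) : 'I_4 := Ordinal H.
Definition ix : 'I_4 := @o4 0 isT.
Definition iy : 'I_4 := @o4 1 isT.
Definition iz : 'I_4 := @o4 2 isT.
Definition it : 'I_4 := @o4 3 isT.

Definition xy (p : 'rV[R]_4) : 'rV[R]_2 :=
  \row_(j < 2) p 0 (widen_ord (isT : (2 <= 4)%N) j).
Definition zc (p : 'rV[R]_4) : R := p 0 iz.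

Definition Mdom (U : set 'rV[R]_2) (V : set R) : set 'rV[R]_4 :=
  [set p | U (xy p) /\ V (zc p)].

Definition dx : 'rV[R]_4 := ebasis ix.
Definition dy : 'rV[R]_4 := ebasis iy.
Definition dz : 'rV[R]_4 := ebasis iz.
Definition dt : 'rV[R]_4 := ebasis it.

Definition theta3 (l2 n2 : 'rV[R]_2 -> R) (beta : R -> R) (p : 'rV[R]_4) : 'rV[R]_4 :=
  (beta (zc p))^-1 *: (dt - l2 (xy p) *: dx - n2 (xy p) *: dy).
Definition theta4 : 'rV[R]_4 := dz.

Definition gSigma (h : 'rV[R]_2 -> R) (p : 'rV[R]_4) : 'M[R]_4 :=
  h (xy p) ^+ 2 *: (dx^T *m dx + dy^T *m dy).
Definition omSigma (h : 'rV[R]_2 -> R) (p : 'rV[R]_4) : 'M[R]_4 :=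
  h (xy p) ^+ 2 *: wedge11 dx dy.

Definition gmetric (h l2 n2 : 'rV[R]_2 -> R) (A beta : R -> R) (p : 'rV[R]_4)
  : 'M[R]_4 :=
  expR (- A (zc p)) *: gSigma h p
  + (theta3 l2 n2 beta p)^T *m theta3 l2 n2 beta p + theta4^T *m theta4.

Definition Omega_bar (h l2 n2 : 'rV[R]_2 -> R) (A beta : R -> R) (p : 'rV[R]_4)
  : 'M[R]_4 :=
  expR (- A (zc p)) *: omSigma h p + wedge11 theta4 (theta3 l2 n2 beta p).

Definition Omega (h l2 n2 : 'rV[R]_2 -> R) (A beta : R -> R) (p : 'rV[R]_4)
  : 'M[R]_4 :=
  expR (- A (zc p)) *: omSigma h p + wedge11 (theta3 l2 n2 beta p) theta4.

End CoordGeom.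

(* Main.v *)
Require Import Defs.
From HB Require Import structures.
From mathcomp Require Import all_boot all_order all_algebra.
From mathcomp Require Import all_classical all_reals all_analysis.
From Stdlib Require ZArith Ring_theory Ring_polynom InitialRing BinList.
Import Order.TTheory GRing.Theory Num.Theory.
Import numFieldNormedType.Exports.
Set Implicit Arguments. Unset Strict Implicit. Unset Printing Implicit Defensive.
Local Open Scope classical_set_scope.
Local Open Scope ring_scope.

(** In the coframe dx, dy, theta3, theta4 everything is explicit.  All component
   functions are polynomials in the partial derivatives of h, l2, n2, in 1/h, in
   the derivatives of alpha, in 1/alpha and in exp(A), exp(-A), because
   1/beta = alpha exp(-A).  On such expressions partial differentiation is a
   formal derivation, so that Christoffel symbols, the Ricci tensor, the
   Nijenhuis tensor and exterior derivatives are computed formally.  The claims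
   then become polynomial identities modulo
   h (1/h) = 1, alpha (1/alpha) = 1, exp(A) exp(-A) = 1, the curl equation
   d_x n2 = d_y l2 + h^2 with its first derivatives, and Schwarz' theorem; they
   are decided by the normaliser of Ring_polynom.  The Ricci tensor is
   diagonal, with one eigenvalue on the span of dx, dy and one on the span of
   theta3, theta4, hence invariant under both complex structures; since
   theta = d(-A), the metric exp(2A) g is Kaehler for J. *)

(** * Partial derivatives of smooth functions and symmetry of mixed partials *)

Section Smooth.
Variable R : realType.

Lemma pd_eq_on n (S : set 'rV[R]_n) (f g : 'rV[R]_n -> R) i p :
  open S -> S p -> (forall q, S q -> f q = g q) -> pd i f p = pd i g p.
Proof.
move=> oS Sp fg; apply: near_eq_derive.
by apply: filterS fg _; exact: open_nbhs_nbhs.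
Qed.

Lemma Ck_eq_on n k (S : set 'rV[R]_n) (f g : 'rV[R]_n -> R) :
  open S -> (forall q, S q -> f q = g q) -> Ck k S g -> Ck k S f.
Proof.
move=> oS; elim: k f g => [|k IH] f g fg /= [cg dg].
all: have gf p : S p -> {near p, g =1 f}
  by move=> Sp; apply: filterS (open_nbhs_nbhs (conj oS Sp)) => q /fg.
all: have cf p : S p -> {for p, continuous f}
  by move=> Sp; rewrite /prop_for /continuous_at (fg _ Sp);
     apply: cvg_trans (cg _ Sp); exact: near_eq_cvg (gf _ Sp).
  by [].
split=> // i; have [dgi Cgi] := dg i; split=> [p Sp|].
  exact: near_eq_derivable (gf _ Sp) (dgi p Sp).
by apply: IH Cgi => q Sq; exact: pd_eq_on Sq fg.
Qed.

Lemma smooth_on_pd n (S : set 'rV[R]_n) (f : 'rV[R]_n -> R) i :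
  smooth_on S f -> smooth_on S (pd i f).
Proof. by move=> sf k; have [_ /(_ i)[]] := sf k.+1. Qed.

Lemma smooth_on_derivable n (S : set 'rV[R]_n) (f : 'rV[R]_n -> R) i p :
  smooth_on S f -> S p -> derivable f p (ebasis R i).
Proof. by move=> /(_ 1%N)[_ /(_ i)[df _]] /df. Qed.

Lemma smooth_on_continuous n (S : set 'rV[R]_n) (f : 'rV[R]_n -> R) p :
  smooth_on S f -> S p -> {for p, continuous f}.
Proof. by move=> /(_ 0%N)[cf _] /cf. Qed.

Lemma xy_continuous : continuous (@xy R).
Proof.
move=> p B /nbhs_ballP[e e0 eB]; apply/nbhs_ballP; exists e => //= q [_ pq].
by apply: eB; split=> // i j; rewrite !mxE; exact: pq.
Qed.

Lemma zc_continuous : continuous (@zc R).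
Proof. exact: coord_continuous. Qed.

Lemma open_Mdom (U : set 'rV[R]_2) (V : set R) :
  open U -> open V -> open (Mdom U V).
Proof.
move=> oU oV; apply: (@openI _ (@xy R @^-1` U) (@zc R @^-1` V)).
  by apply: open_comp oU => p _; exact: xy_continuous.
by apply: open_comp oV => p _; exact: zc_continuous.
Qed.

Lemma xyD (p q : 'rV[R]_4) (s : R) : xy (s *: q + p) = s *: xy q + xy p.
Proof. by apply/rowP=> j; rewrite !mxE. Qed.

Lemma xy_ebasis (j : 'I_2) (i : 'I_4) : val j = val i ->
  xy (ebasis R i) = ebasis R j.
Proof. by move=> ji; apply/rowP=> k; rewrite !mxE -!val_eqE /= ji. Qed.

Lemma xy_ebasis0 (i : 'I_4) : (2 <= i)%N -> xy (ebasis R i) = 0.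
Proof.
move=> i2; apply/rowP=> k; rewrite !mxE -!val_eqE /=.
by rewrite ltn_eqF // (leq_trans (ltn_ord k)).
Qed.

(** Since [xy] is linear, both difference quotients are the same function, which yields derivability
    and value at once. *)
Lemma derive_xy_eq (f : 'rV[R]_2 -> R) p v :
  (derivable (fun q => f (xy q)) p v = derivable f (xy p) (xy v)) *
  ('D_v (fun q => f (xy q)) p = 'D_(xy v) f (xy p)).
Proof.
rewrite /derivable /derive.
suff -> : (fun h : R => h^-1 *: (((fun q => f (xy q)) \o shift p) (h *: v) - f (xy p)))
   = (fun h : R => h^-1 *: ((f \o shift (xy p)) (h *: xy v) - f (xy p))) by [].
by apply/funext=> h /=; rewrite xyD.
Qed.

Lemma derive_zc_eq (f : R -> R) p v :
  (derivable (fun q => f (zc q)) p v = derivable f (zc p) (zc v)) *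
  ('D_v (fun q => f (zc q)) p = 'D_(zc v) f (zc p)).
Proof.
rewrite /derivable /derive.
suff -> : (fun h : R => h^-1 *: (((fun q => f (zc q)) \o shift p) (h *: v) - f (zc p)))
   = (fun h : R => h^-1 *: ((f \o shift (zc p)) (h *: zc v) - f (zc p))) by [].
by apply/funext=> h /=; rewrite /zc !mxE.
Qed.

Lemma zc_ebasis (i : 'I_4) : zc (ebasis R i) = (val i == 2%N)%:R.
Proof. by rewrite /zc mxE -!val_eqE /= eq_sym. Qed.

Lemma is_derive_xy (f : 'rV[R]_2 -> R) (j : 'I_2) (i : 'I_4) p df :
  val j = val i -> is_derive (xy p) (ebasis R j) f df ->
  is_derive p (ebasis R i) (fun q => f (xy q)) df.
Proof.
by move=> ji [fd <-]; apply: DeriveDef; rewrite derive_xy_eq (xy_ebasis ji).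
Qed.

Lemma is_derive_xy0 (f : 'rV[R]_2 -> R) (i : 'I_4) p :
  (2 <= i)%N -> is_derive p (ebasis R i) (fun q => f (xy q)) 0.
Proof.
move=> i2; apply: DeriveDef; rewrite derive_xy_eq xy_ebasis0 //.
  exact: derivable0.
exact: derive0.
Qed.

Lemma is_derive_zc (f : R -> R) (i : 'I_4) p df :
  is_derive (zc p) 1 f df ->
  is_derive p (ebasis R i) (fun q => f (zc q)) (if val i == 2%N then df else 0).
Proof.
move=> [fd <-]; apply: DeriveDef; rewrite derive_zc_eq zc_ebasis.
  by case: (_ == _); [exact: fd|exact: derivable0].
by case: (_ == _); [|exact: derive0].
Qed.

(** The derivative has the shape that [Datom_xy] and [Datom_z] assign to the inverse atoms. *)
Lemma is_derive_inv (W : normedModType R) (f : W -> R) x v df :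
  f x != 0 -> is_derive x v f df ->
  is_derive x v (fun y => (f y)^-1) (- (df * ((f x)^-1 * (f x)^-1))).
Proof.
move=> fx0 [fd <-]; apply: DeriveDef; first exact: derivableV.
by rewrite deriveV // scaleNr expr2 invfM [_ *: _]mulrC.
Qed.

(** Restriction to a line turns a directional derivative into an ordinary one, so the one-variable
    chain rule and mean value theorem apply. *)
Lemma derive_line_eq (W : normedModType R) (f : W -> R) (q v : W) (s : R) :
  (derivable (fun t : R => f (t *: v + q)) s 1 = derivable f (s *: v + q) v) *
  ('D_1 (fun t : R => f (t *: v + q)) s = 'D_v f (s *: v + q)).
Proof.
rewrite /derivable /derive.
suff -> : (fun t : R => t^-1 *: (((fun t => f (t *: v + q)) \o shift s) (t *: 1)
     - f (s *: v + q)))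
  = (fun t : R => t^-1 *: ((f \o shift (s *: v + q)) (t *: v) - f (s *: v + q))) by [].
by apply/funext=> t /=; rewrite scalerDl addrA [t *: 1]mulr1.
Qed.

Lemma smooth_on_line n (S : set 'rV[R]_n) (f : 'rV[R]_n -> R) (q : 'rV[R]_n) i (s : R) :
  smooth_on S f -> S (s *: ebasis R i + q) ->
  is_derive s 1 (fun t => f (t *: ebasis R i + q)) (pd i f (s *: ebasis R i + q)).
Proof.
move=> sf Sp; have df := smooth_on_derivable (i := i) sf Sp.
by apply: DeriveDef; rewrite derive_line_eq.
Qed.

Lemma pd_ln n (S : set 'rV[R]_n) (f : 'rV[R]_n -> R) (q : 'rV[R]_n) i :
  smooth_on S f -> S q -> 0 < f q ->
  pd i (fun x => ln (f x)) q = pd i f q * (f q)^-1.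
Proof.
move=> sf Sq fq; rewrite /pd -[in LHS](add0r q) -(scale0r (ebasis R i)).
rewrite -(derive_line_eq (fun x => ln (f x))) mulrC.
have q0 : 0 *: ebasis R i + q = q by rewrite scale0r add0r.
have fd := @smooth_on_line n S f q i 0 sf; rewrite q0 in fd.
have lnd : is_derive (f (0 *: ebasis R i + q)) 1 (@ln R) (f q)^-1.
  by rewrite q0; exact: is_derive1_ln.
by have [] := is_derive1_comp lnd (fd Sq).
Qed.

(** The mean value theorem on [0, d] for the difference of [f] along two parallel segments. *)
Lemma smooth_on_MVT n (S : set 'rV[R]_n) (f : 'rV[R]_n -> R)
    (p q : 'rV[R]_n) i (d : R) :
  smooth_on S f -> 0 < d ->
  (forall s, 0 <= s <= d -> S (s *: ebasis R i + p)) ->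
  (forall s, 0 <= s <= d -> S (s *: ebasis R i + q)) ->
  exists2 s, 0 <= s <= d &
    (f (d *: ebasis R i + p) - f (d *: ebasis R i + q)) - (f p - f q)
    = (pd i f (s *: ebasis R i + p) - pd i f (s *: ebasis R i + q)) * d.
Proof.
move=> sf d0 Sp Sq.
pose phi t := f (t *: ebasis R i + p) - f (t *: ebasis R i + q).
have dphi s : 0 <= s <= d -> is_derive s 1 phi
    (pd i f (s *: ebasis R i + p) - pd i f (s *: ebasis R i + q)).
  move=> sd; apply: is_deriveB; apply: smooth_on_line sf _; [exact: Sp|exact: Sq].
pose dph s := pd i f (s *: ebasis R i + p) - pd i f (s *: ebasis R i + q).
have [s sd E] : exists2 s, s \in `]0, d[ & phi d - phi 0 = dph s * (d - 0).
  apply: (MVT (df := dph) d0).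
    by move=> s /itvP sd; apply: dphi; rewrite !sd.
  apply: derivable_within_continuous => s /itvP sd.
  by have [|//] := dphi s _; rewrite !sd.
exists s; first by rewrite !(itvP sd).
by move: E; rewrite /phi subr0 !scale0r !add0r.
Qed.

(** Mean value theorem twice: in direction [i] for the difference of [f] along two parallel
    segments, then in direction [j] for [pd i f]. *)
Lemma second_difference n (S : set 'rV[R]_n) (f : 'rV[R]_n -> R)
    (p : 'rV[R]_n) i j (d : R) :
  smooth_on S f -> 0 < d ->
  (forall s t, 0 <= s <= d -> 0 <= t <= d ->
     S (s *: ebasis R i + (t *: ebasis R j + p))) ->
  exists s t, [/\ 0 <= s <= d, 0 <= t <= d &
    f (d *: ebasis R i + (d *: ebasis R j + p)) - f (d *: ebasis R i + p)
    - (f (d *: ebasis R j + p) - f p)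
    = pd j (pd i f) (s *: ebasis R i + (t *: ebasis R j + p)) * (d * d)].
Proof.
move=> sf d0 Sd.
have d1 : 0 <= d <= d by rewrite lexx ltW.
have d2 : 0 <= (0 : R) <= d by rewrite lexx ltW.
have [|u ud|s sd ->] := @smooth_on_MVT n S f (d *: ebasis R j + p) p i d sf d0.
- by move=> u ud; exact: Sd.
- by rewrite -[p]add0r -(scale0r (ebasis R j)); exact: Sd.
pose q := s *: ebasis R i + p.
have Eq (u : R) : s *: ebasis R i + (u *: ebasis R j + p) = u *: ebasis R j + q.
  by rewrite /q addrCA.
have dg (u : R) : 0 <= u <= d -> is_derive u 1 (fun t => pd i f (t *: ebasis R j + q))
    (pd j (pd i f) (u *: ebasis R j + q)).
  by move=> ud; apply: (smooth_on_line (smooth_on_pd i sf)); rewrite -Eq; exact: Sd.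
have [t td E] : exists2 t, t \in `]0, d[ &
     pd i f (d *: ebasis R j + q) - pd i f (0 *: ebasis R j + q)
     = pd j (pd i f) (t *: ebasis R j + q) * (d - 0).
  apply: (MVT (f := fun t => pd i f (t *: ebasis R j + q))
           (df := fun t => pd j (pd i f) (t *: ebasis R j + q)) d0).
    by move=> u /itvP ud; apply: dg; rewrite !ud.
  apply: derivable_within_continuous => u /itvP ud.
  by have [|//] := dg u _; rewrite !ud.
exists s, t; split=> //; first by rewrite !(itvP td).
by rewrite !Eq mulrA; congr (_ * d); move: E; rewrite subr0 scale0r add0r.
Qed.

(* Schwarz: both mixed partials, taken at points near p, equal the second
   difference quotient. *)
Lemma pd_comm n (S : set 'rV[R]_n) (f : 'rV[R]_n -> R) (p : 'rV[R]_n) i j :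
  open S -> smooth_on S f -> S p -> pd i (pd j f) p = pd j (pd i f) p.
Proof.
move=> oS sf Sp; apply/eqP/negPn/negP => neq.
(* Half the gap between the two mixed partials: a common value this close to both contradicts the
   triangle inequality. *)
pose e := `|pd i (pd j f) p - pd j (pd i f) p| / 2.
have e0 : 0 < e by rewrite divr_gt0 // normr_gt0 subr_eq0.
have near_p a b : \forall q \near p, `|pd a (pd b f) p - pd a (pd b f) q| < e.
  have /cvgrPdist_lt := smooth_on_continuous (smooth_on_pd a (smooth_on_pd b sf)) Sp.
  exact.
have /nbhs_ballP[r /= r0 rP] : nbhs p (S `&`
    ([set q | `|pd i (pd j f) p - pd i (pd j f) q| < e] `&`
     [set q | `|pd j (pd i f) p - pd j (pd i f) q| < e])).
  by apply: filterI; [exact: open_nbhs_nbhs|apply: filterI; exact: near_p].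
pose m := `|ebasis R i| + `|ebasis R j| + 1.
have m0 : 0 < m by rewrite ltr_wpDl // addr_ge0.
(* With this side length every point of the box lies within d * m = r / 2 of [p]. *)
pose d := r / (2 * m).
have d0 : 0 < d by rewrite divr_gt0 // mulr_gt0.
have ball_box a b (s t : R) : `|ebasis R a| + `|ebasis R b| + 1 = m ->
    0 <= s <= d -> 0 <= t <= d ->
    ball p r (s *: ebasis R a + (t *: ebasis R b + p)).
  move=> mE /andP[s0 sd] /andP[t0 td].
  rewrite -ball_normE /ball_ /= addrA opprD addrCA subrr addr0 normrN.
  apply: le_lt_trans (ler_normD _ _) _; rewrite !normrZ !ger0_norm //.
  apply: (@le_lt_trans _ _ (d * m)).
    rewrite -mE mulrDr mulr1 mulrDr -[X in X <= _]addr0; apply: lerD; last exact: ltW.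
    by apply: lerD; apply: ler_wpM2r.
  rewrite /d invfM mulrA divfK ?gt_eqF // ltr_pdivrMr // ltr_pMr // ltr1n //.
have [s [t [sd td E1]]] : exists s t, [/\ 0 <= s <= d, 0 <= t <= d & _] :=
  @second_difference n S f p i j d sf d0 (fun s t sd td =>
    let: conj Sq _ := rP _ (ball_box i j s t erefl sd td) in Sq).
have mji : `|ebasis R j| + `|ebasis R i| + 1 = m by rewrite addrC [_ + `|_|]addrC -addrC.
have [t' [s' [td' sd' E2]]] := @second_difference n S f p j i d sf d0 (fun s t sd td =>
    let: conj Sq _ := rP _ (ball_box j i s t mji sd td) in Sq).
have [_ [_ H1]] := rP _ (ball_box i j s t erefl sd td).
have [_ [H2 _]] := rP _ (ball_box j i t' s' mji td' sd').
(* The second difference is symmetric in the two directions. *)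
have swap (a b c v : R) : a - b - (c - v) = a - c - (b - v).
  by rewrite !opprD !opprK addrACA.
have close (a b x y c : R) : c != 0 -> x * c = y * c ->
    `|a - x| < `|a - b| / 2 -> `|b - y| < `|a - b| / 2 -> False.
  move=> c0 /(mulIf c0) -> ax by_; have := ltrD ax by_.
  by rewrite -splitr ltNge (distrC b) ler_distD.
apply: (close _ _ _ _ (d * d) _ _ H2 H1); first by rewrite mulf_neq0 // gt_eqF.
apply: etrans (esym E2) (etrans _ E1); rewrite swap; congr (f _ - _ - _).
exact: addrCA.
Qed.

End Smooth.

(** * Formal derivatives and curvature *)

Inductive base_fun := Fh | Fl | Fn.

(* [Abase f s] is an iterated partial derivative of f, outermost first, where
   [false] stands for d_x and [true] for d_y; [Aalpha k] is the k-th derivative. *)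
Inductive atom :=
  | Abase of base_fun & seq bool
  | Ahinv
  | Aalpha of nat
  | Aalphainv
  | AA
  | AexpA
  | AexpNA
  | Ahalf.

(** [Defined] keeps the decision transparent, so that [index] and membership in [jet_vars] reduce
    under [vm_compute]. *)
Lemma atom_eq_dec : comparable atom.
Proof. by move=> a b; rewrite /decidable; repeat decide equality. Defined.

HB.instance Definition _ := hasDecEq.Build atom (compareP atom_eq_dec).

Inductive jet :=
  | J0 | J1 | Jv of atom
  | Jadd of jet & jet | Jmul of jet & jet | Jopp of jet.

Declare Scope jet_scope.
Delimit Scope jet_scope with J.
Bind Scope jet_scope with jet.
Notation "0" := J0 : jet_scope.
Notation "1" := J1 : jet_scope.
Notation "x + y" := (Jadd x y) : jet_scope.
Notation "x * y" := (Jmul x y) : jet_scope.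
Notation "- x" := (Jopp x) : jet_scope.
Notation "x - y" := (Jadd x (Jopp y)) : jet_scope.

Local Open Scope jet_scope.

Definition jh := Jv (Abase Fh [::]).
Definition jl := Jv (Abase Fl [::]).
Definition jn := Jv (Abase Fn [::]).
Definition jhinv := Jv Ahinv.
Definition jalpha k := Jv (Aalpha k).
Definition jalphainv := Jv Aalphainv.
Definition jexpA := Jv AexpA.
Definition jexpNA := Jv AexpNA.
Definition jhalf := Jv Ahalf.

Definition Datom_xy (b : bool) (a : atom) : jet :=
  match a with
  | Abase f s => Jv (Abase f (b :: s))
  | Ahinv => - (Jv (Abase Fh [:: b]) * (jhinv * jhinv))
  | _ => 0
  end.

Definition Datom_z (a : atom) : jet :=
  match a with
  | Aalpha k => jalpha k.+1
  | Aalphainv => - (jalpha 1 * (jalphainv * jalphainv))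
  | AA => jalpha 0
  | AexpA => jalpha 0 * jexpA
  | AexpNA => - (jalpha 0 * jexpNA)
  | _ => 0
  end.

(** Directions 0 to 3 are x, y, z, t; no atom depends on t. *)
Definition Datom (i : nat) (a : atom) : jet :=
  match i with
  | 0%N => Datom_xy false a
  | 1%N => Datom_xy true a
  | 2%N => Datom_z a
  | _ => 0
  end.

(** The Leibniz terms stand in the order of [is_deriveM], so that evaluation agrees with it by
    conversion. *)
Fixpoint jD (i : nat) (e : jet) : jet :=
  match e with
  | J0 | J1 => 0
  | Jv a => Datom i a
  | Jadd e1 e2 => jD i e1 + jD i e2
  | Jmul e1 e2 => e1 * jD i e2 + e2 * jD i e1
  | Jopp e => - jD i e
  end.

Definition jsum4 (F : nat -> jet) := F 0%N + (F 1%N + (F 2%N + F 3%N)).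
Definition jdelta (a i : nat) : jet := if a == i then 1 else 0.

Definition jtheta3 i :=
  (jalpha 0 * jexpNA) * (jdelta 3 i - jl * jdelta 0 i - jn * jdelta 1 i).
Definition jtheta4 := jdelta 2.

Definition jg i j :=
  jexpNA * (jh * jh * (jdelta 0 i * jdelta 0 j + jdelta 1 i * jdelta 1 j))
  + jtheta3 i * jtheta3 j + jtheta4 i * jtheta4 j.

(* The frame dual to dx, dy, dz, theta3 (in this order). *)
Definition jframe i j : jet :=
  match i with
  | 0%N => jdelta 0 j + jl * jdelta 3 j
  | 1%N => jdelta 1 j + jn * jdelta 3 j
  | 2%N => jdelta 2 j
  | _ => (jalphainv * jexpA) * jdelta 3 j
  end.

(** The inverse metric, read off in the dual frame; this avoids a formal matrix inversion. *)
Definition jginv i j :=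
  jexpA * (jhinv * jhinv * (jframe 0 i * jframe 0 j + jframe 1 i * jframe 1 j))
  + jframe 2 i * jframe 2 j + jframe 3 i * jframe 3 j.

Definition jchrist k i j :=
  jhalf * jsum4 (fun l => jginv k l * (jD i (jg j l) + jD j (jg i l) - jD l (jg i j))).

Definition jricci j k :=
  jsum4 (fun i => jD i (jchrist i j k) - jD j (jchrist i i k)
   + jsum4 (fun m => jchrist m j k * jchrist i i m - jchrist m i k * jchrist i j m)).

Definition jsgn (s : bool) e : jet := if s then e else - e.

(* [s = true] is Omega and J, [s = false] is their barred counterparts. *)
Definition jOmega s i j :=
  jexpNA * (jh * jh * (jdelta 0 i * jdelta 1 j - jdelta 1 i * jdelta 0 j))
  + jsgn s (jtheta3 i * jtheta4 j - jtheta4 i * jtheta3 j).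

(** A quarter turn in each of two orthogonal planes. The sign reverses only the plane of [jframe 2]
    and [jframe 3], so the two structures induce opposite orientations. *)
Definition jJ s i j :=
  jdelta 0 i * jframe 1 j - jdelta 1 i * jframe 0 j
  + jsgn s (jtheta3 i * jframe 2 j - jtheta4 i * jframe 3 j).

Definition jmulmx (F G : nat -> nat -> jet) i j := jsum4 (fun k => F i k * G k j).

Definition jd2form (F : nat -> nat -> jet) i j k :=
  jD i (F j k) + jD j (F k i) + jD k (F i j).

Definition jnijenhuis (F : nat -> nat -> jet) i j a :=
  jsum4 (fun b => F i b * jD b (F j a) - F j b * jD b (F i a)
                  + jD j (F i b) * F b a - jD i (F j b) * F b a).

Definition jlap_ln_h :=
  jD 0 (Jv (Abase Fh [:: false]) * jhinv) + jD 1 (Jv (Abase Fh [:: true]) * jhinv).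
Definition jbeta := jexpA * jalphainv.
Definition jbetainv := jalpha 0 * jexpNA.

(* [jricci_v] is the Ricci eigenvalue on the span of theta3 and theta4, [jricci_h]
   is exp(-A) h^2 times the one on the span of dx and dy. *)
Definition jricci_v :=
  - (1+1+1) * jhalf * jalpha 0 * jalpha 0 + (1+1+1+1) * jalpha 1
  - jalpha 2 * jalphainv.
Definition jricci_h :=
  (jalpha 1 - (1+1+1) * jhalf * jalpha 0 * jalpha 0) * (jexpNA * jh * jh)
  - jlap_ln_h.
Definition jricci_diag i j :=
  jricci_h * (jdelta 0 i * jdelta 0 j + jdelta 1 i * jdelta 1 j)
  + jricci_v * (jtheta3 i * jtheta3 j + jtheta4 i * jtheta4 j).

Definition jscal :=
  (1+1) * (- jlap_ln_h * jexpA * (jhinv * jhinv)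
   - (1+1) * (jalpha 0 * jalpha 0) + (1+1) * jalpha 1
   + jD 2 (jD 2 jbeta) * jbetainv
   - (1+1) * ((jD 2 jbeta * jbetainv) * (jD 2 jbeta * jbetainv))).

(* The factors of the monomials on the left of [jet_rels] must be consecutive
   variables: [Ring_polynom.MFactor] misses monomials whose variables are not
   adjacent. *)
Definition jet_vars :=
  [:: Ahalf; Ahinv; Abase Fh [::]; Aalphainv; Aalpha 0; AexpNA; AexpA;
      Aalpha 1; Aalpha 2; AA; Abase Fl [::]; Abase Fn [::]]
  ++ [seq Abase f s | s <- [:: [:: false]; [:: true]; [:: false; false];
        [:: true; true]; [:: true; false]; [:: false; true]],
        f <- [:: Fh; Fl; Fn]].

(** Rewrite rules from left to right. The x-derivatives of n2 are eliminated by the curl equation;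
    words of length two suffice since curvature is of second order in the metric. *)
Definition jet_rels : seq (jet * jet) :=
  [:: (Jv (Abase Fh [:: true; false]), Jv (Abase Fh [:: false; true]));
      (Jv (Abase Fl [:: true; false]), Jv (Abase Fl [:: false; true]));
      (Jv (Abase Fn [:: false]), Jv (Abase Fl [:: true]) + jh * jh);
      (Jv (Abase Fn [:: false; false]),
       Jv (Abase Fl [:: false; true]) + (1 + 1) * (jh * Jv (Abase Fh [:: false])));
      (Jv (Abase Fn [:: true; false]),
       Jv (Abase Fl [:: true; true]) + (1 + 1) * (jh * Jv (Abase Fh [:: true])));
      (Jv (Abase Fn [:: false; true]),
       Jv (Abase Fl [:: true; true]) + (1 + 1) * (jh * Jv (Abase Fh [:: true])));
      (jh * jhinv, 1);
      (jalpha 0 * jalphainv, 1);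
      (jexpA * jexpNA, 1);
      ((1 + 1) * jhalf, 1)].

Local Close Scope jet_scope.

(** * Reflection into the polynomial normaliser *)

Import BinNums.

Lemma BinList_nth_succ (T : Type) (d : T) p (s : seq T) :
  BinList.nth d (BinPos.Pos.succ p) s = BinList.nth d p (List.tl s).
Proof.
elim: p s => [p IH|p IH|] s //=.
by rewrite IH BinList.jump_succ /= !BinList.jump_tl.
Qed.

(** The normaliser numbers its variables from 1, while [nth] counts from 0. *)
Lemma BinList_nth_of_succ_nat (T : Type) (d : T) k (s : seq T) :
  BinList.nth d (BinPos.Pos.of_succ_nat k) s = nth d s k.
Proof.
elim: k s => [|k IH] s /=; first by case: s.
by rewrite BinList_nth_succ IH; case: s; rewrite /= ?nth_nil.
Qed.

Fixpoint jet_atoms (e : jet) : seq atom :=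
  match e with
  | J0 | J1 => [::]
  | Jv a => [:: a]
  | Jadd e1 e2 | Jmul e1 e2 => jet_atoms e1 ++ jet_atoms e2
  | Jopp e1 => jet_atoms e1
  end.

(** An atom outside [jet_vars] would become an out-of-range variable of value 0; the membership test
    in [jcheck] rules this out. *)
Fixpoint compile (e : jet) : Ring_polynom.PExpr Z :=
  match e with
  | J0 => Ring_polynom.PEO
  | J1 => Ring_polynom.PEI
  | Jv a => Ring_polynom.PEX _ (BinPos.Pos.of_succ_nat (index a jet_vars))
  | Jadd e1 e2 => Ring_polynom.PEadd (compile e1) (compile e2)
  | Jmul e1 e2 => Ring_polynom.PEmul (compile e1) (compile e2)
  | Jopp e1 => Ring_polynom.PEopp (compile e1)
  end.

(** The number 20 bounds the rewriting rounds; too small a bound could only make a check fail, never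
    validate a false identity. *)
Definition jnorm (r : seq (Ring_polynom.PExpr Z * Ring_polynom.PExpr Z))
    (e : Ring_polynom.PExpr Z) :=
  Ring_polynom.norm_subst Z0 (Zpos xH) BinInt.Z.add BinInt.Z.mul BinInt.Z.sub
    BinInt.Z.opp BinInt.Z.eqb BinInt.Z.quotrem 20
    (Ring_polynom.mk_monpol_list Z0 (Zpos xH) BinInt.Z.add BinInt.Z.mul
       BinInt.Z.sub BinInt.Z.opp BinInt.Z.eqb BinInt.Z.quotrem r) e.

Definition compiled_rels := [seq (compile r.1, compile r.2) | r <- jet_rels].

(* Normal forms modulo [2 * jhalf = 1] are not unique, hence the comparison of
   the difference with zero. *)
Definition jcheck (e1 e2 : jet) : bool :=
  let e := (e1 - e2)%J in
  all (mem jet_vars) (jet_atoms e) &&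
  Ring_polynom.Peq BinInt.Z.eqb (jnorm compiled_rels (compile e))
    (jnorm compiled_rels Ring_polynom.PEO).

Definition jcheck2 (F G : nat -> nat -> jet) : bool :=
  all (fun i => all (fun j => jcheck (F i j) (G i j)) (iota 0 4)) (iota 0 4).
Definition jcheck3 (F G : nat -> nat -> nat -> jet) : bool :=
  all (fun i => jcheck2 (F i) (G i)) (iota 0 4).

(** * Polynomial identities verified by computation *)

Lemma jginv_check : jcheck2 (jmulmx jg jginv) jdelta.
Proof. by vm_compute. Qed.

(** Lets the later identities use [jricci_diag], whose entries are far smaller than those of
    [jricci]. *)
Lemma jricci_check : jcheck2 jricci jricci_diag.
Proof. by vm_compute. Qed.

Lemma jscal_check :
  jcheck (jsum4 (fun j => jsum4 (fun k => jginv j k * jricci_diag j k)%J)) jscal.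
Proof. by vm_compute. Qed.

Lemma jOmega_check s : jcheck2 (jmulmx (jJ s) jg) (jOmega s).
Proof. by case: s; vm_compute. Qed.

Lemma jJ2_check s : jcheck2 (jmulmx (jJ s) (jJ s)) (fun i j => - jdelta i j)%J.
Proof. by case: s; vm_compute. Qed.

(** By [jOmega_check], [jOmega s] stands for the product of J and g, so this is the orthogonality of
    J. *)
Lemma jJorth_check s : jcheck2 (jmulmx (jOmega s) (fun i j => jJ s j i)) jg.
Proof. by case: s; vm_compute. Qed.

Lemma jnijenhuis_check s : jcheck3 (jnijenhuis (jJ s)) (fun _ _ _ => J0).
Proof. by case: s; vm_compute. Qed.

Lemma jOmega_bar_closed_check : jcheck3 (jd2form (jOmega false)) (fun _ _ _ => J0).
Proof. by vm_compute. Qed.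

(** The Kaehler form of exp(2A) g. It is closed because d(exp(2A) Omega) = 2 exp(2A) (dA + theta) /\
    Omega with theta = - dA. *)
Definition jOmega_conf i j : jet := (jexpA * jexpA * jOmega true i j)%J.

Lemma jOmega_conf_closed_check : jcheck3 (jd2form jOmega_conf) (fun _ _ _ => J0).
Proof. by vm_compute. Qed.

Definition jLee_wedge_Omega i j k : jet :=
  ((1 + 1) * (- jalpha 0 * jtheta4 i * jOmega true j k
    + - jalpha 0 * jtheta4 j * jOmega true k i
    + - jalpha 0 * jtheta4 k * jOmega true i j))%J.

Lemma jLee_check : jcheck3 (jd2form (jOmega true)) jLee_wedge_Omega.
Proof. by vm_compute. Qed.

Lemma jricci_inv_check :
  jcheck2 (jmulmx (jmulmx (jJ true) jricci_diag) (fun i j => jJ true j i)) jricci_diag.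
Proof. by vm_compute. Qed.

(** * Soundness of the normaliser over a commutative ring *)

Section RingNorm.
Variable R : comNzRingType.

Lemma comRing_ring_theory :
  Ring_theory.ring_theory (0 : R) 1 +%R *%R (fun x y => x - y) -%R eq.
Proof.
by split=> //; [exact: add0r|exact: addrC|exact: addrA|exact: mul1r|exact: mulrC
  |exact: mulrA|exact: mulrDl|exact: subrr].
Qed.

Definition comRing_morph :=
  InitialRing.gen_phiZ_morph (RelationClasses.eq_equivalence (A := R))
    (Ring_theory.Eq_ext +%R *%R -%R) comRing_ring_theory.

Definition PEev := Ring_polynom.PEeval (0 : R) 1 +%R *%R (fun x y => x - y) -%R
  (InitialRing.gen_phiZ 0 1 +%R *%R -%R) (@Ring_theory.id_phi_N)
  (Ring_theory.pow_N 1 *%R).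

Lemma PEev_eq l r e1 e2 :
  Ring_polynom.interp_PElist 0 1 +%R *%R (fun x y => x - y) -%R eq
    (InitialRing.gen_phiZ 0 1 +%R *%R -%R) (@Ring_theory.id_phi_N)
    (Ring_theory.pow_N 1 *%R) l r ->
  Ring_polynom.Peq BinInt.Z.eqb (jnorm r e1) (jnorm r e2) -> PEev l e1 = PEev l e2.
Proof.
apply: (Ring_polynom.ring_correct (RelationClasses.eq_equivalence (A := R))
  (Ring_theory.Eq_ext +%R *%R -%R)
  (Ring_theory.Rth_ARth (RelationClasses.eq_equivalence (A := R))
     (Ring_theory.Eq_ext +%R *%R -%R) comRing_ring_theory)
  comRing_morph
  (Ring_theory.pow_N_th 1 *%R (RelationClasses.eq_equivalence (A := R)))
  (InitialRing.Ztriv_div_th (RelationClasses.eq_equivalence (A := R))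
     (InitialRing.gen_phiZ 0 1 +%R *%R -%R))).
Qed.

End RingNorm.

(** * Values of formal expressions at a point *)

Section Eval.
Variables (R : realType) (h l2 n2 : 'rV[R]_2 -> R) (alpha A : R -> R).
Variables (U : set 'rV[R]_2) (V : set R).

Definition base_val (b : base_fun) :=
  match b with Fh => h | Fl => l2 | Fn => n2 end.

Definition pd_word (s : seq bool) (f : 'rV[R]_2 -> R) : 'rV[R]_2 -> R :=
  foldr (fun b : bool => pd (if b then 1 else 0)) f s.

Definition atom_val (p : 'rV[R]_4) (a : atom) : R :=
  match a with
  | Abase f s => pd_word s (base_val f) (xy p)
  | Ahinv => (h (xy p))^-1
  | Aalpha k => derive1n k alpha (zc p)
  | Aalphainv => (alpha (zc p))^-1
  | AA => A (zc p)
  | AexpA => expR (A (zc p))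
  | AexpNA => expR (- A (zc p))
  | Ahalf => 2^-1
  end.

Fixpoint ev (p : 'rV[R]_4) (e : jet) : R :=
  match e with
  | J0 => 0
  | J1 => 1
  | Jv a => atom_val p a
  | Jadd e1 e2 => ev p e1 + ev p e2
  | Jmul e1 e2 => ev p e1 * ev p e2
  | Jopp e1 => - ev p e1
  end.

Lemma ev_compile p e : all (mem jet_vars) (jet_atoms e) ->
  PEev [seq atom_val p a | a <- jet_vars] (compile e) = ev p e.
Proof.
elim: e => //= [a|e1 IH1 e2 IH2|e1 IH1 e2 IH2|e1 IH1].
- rewrite andbT => av; rewrite /PEev -[LHS]/(BinList.nth 0 (BinPos.Pos.of_succ_nat
    (index a jet_vars)) [seq atom_val p a | a <- jet_vars]) BinList_nth_of_succ_nat.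
  by rewrite (nth_map a) ?index_mem // nth_index.
- by rewrite all_cat => /andP[/IH1 <- /IH2 <-].
- by rewrite all_cat => /andP[/IH1 <- /IH2 <-].
- by move=> /IH1 <-.
Qed.

(** Rewriting by the relations preserves the value at any point where they hold, so a difference
    that normalises to zero vanishes there. *)
Lemma jcheckP p e1 e2 : (forall r, List.In r jet_rels -> ev p r.1 = ev p r.2) ->
  jcheck e1 e2 -> ev p e1 = ev p e2.
Proof.
move=> jet_relsP /andP[wf chk]; apply/eqP; rewrite -subr_eq0; apply/eqP.
rewrite -[LHS]/(ev p (e1 - e2)%J) -ev_compile //.
apply: PEev_eq chk.
have : all (fun r => all (mem jet_vars) (jet_atoms r.1 ++ jet_atoms r.2)) jet_rels.
  by vm_compute.
rewrite /compiled_rels.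
elim: jet_rels jet_relsP => [//|[a b] s IH] jet_relsP /= /andP[].
rewrite all_cat => /andP[wa wb] ws.
have ab := jet_relsP _ (or_introl erefl).
have {}IH := IH (fun r rs => jet_relsP _ (or_intror rs)) ws.
(* [interp_PElist] puts no trailing [True] after the last equation, so the one-element list is a
   separate case. *)
by case: s IH {jet_relsP ws} => [_|r s IH] /=; [|split=> //];
  move: (ev_compile p wa) (ev_compile p wb); rewrite /PEev => -> ->.
Qed.

End Eval.

(** * The metric of the theorem *)

Section Geometry.
Variables (R : realType) (U : set 'rV[R]_2) (V : set R).
Variables (h l2 n2 : 'rV[R]_2 -> R) (alpha A beta : R -> R).
Hypotheses (oU : open U) (sh : smooth_on U h) (h0 : forall q, U q -> 0 < h q).
Hypotheses (oV : open V) (sa : smooth1_on V alpha).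
Hypothesis a0 : forall z, V z -> alpha z != 0.
Hypothesis dA : forall z, V z -> is_derive z 1 A (alpha z).
Hypothesis ba : forall z, V z -> beta z * alpha z = expR (A z).
Hypotheses (sl : smooth_on U l2) (sn : smooth_on U n2).
Hypothesis curl : forall q, U q -> pd 0 n2 q - pd 1 l2 q = h q ^+ 2.

Local Notation M := (Mdom U V).
Local Notation ev := (ev h l2 n2 alpha A).
Local Notation atom_val := (atom_val h l2 n2 alpha A).

(** * Formal derivatives are actual derivatives *)

Lemma smooth_base_word f s : smooth_on U (pd_word s (base_val h l2 n2 f)).
Proof.
elim: s => [|b s IH]; first by case: f.
exact: smooth_on_pd.
Qed.

Lemma smooth1_continuous k z : V z -> {for z, continuous (derive1n k alpha)}.
Proof.
by move=> Vz; apply: differentiable_continuous; apply/derivable1_diffP; exact: sa.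
Qed.

Lemma A_continuous z : V z -> {for z, continuous A}.
Proof.
by move=> /dA[Ad _]; apply: differentiable_continuous; apply/derivable1_diffP.
Qed.

Lemma atom_continuous p a : M p -> {for p, continuous (atom_val^~ a)}.
Proof.
move=> [Up Vp].
have cxy (f : 'rV[R]_2 -> R) : {for xy p, continuous f} ->
    {for p, continuous (fun q => f (@xy R q))}.
  by move=> cf; exact: (continuous_comp (xy_continuous (x := p)) cf).
have czc (f : R -> R) : {for zc p, continuous f} ->
    {for p, continuous (fun q => f (@zc R q))}.
  by move=> cf; exact: (continuous_comp (zc_continuous (x := p)) cf).
case: a => [f s||k|||||] /=.
- by apply: cxy; exact: smooth_on_continuous (smooth_base_word f s) Up.
- apply: (cxy (fun q => (h q)^-1)); apply: continuousV; first by rewrite gt_eqF ?h0.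
  exact: smooth_on_continuous sh Up.
- by apply: czc; exact: smooth1_continuous.
- apply: (czc (fun z => (alpha z)^-1)); apply: continuousV; first exact: a0.
  exact: (@smooth1_continuous 0).
- by apply: czc; exact: A_continuous.
- apply: (czc (fun z => expR (A z))); apply: continuous_comp; first exact: A_continuous.
  exact: continuous_expR.
- apply: (czc (fun z => expR (- A z))); apply: continuous_comp.
    by apply: continuousN; exact: A_continuous.
  exact: continuous_expR.
- exact: cst_continuous.
Qed.

(** Each atom is constant or factors through [xy] or [zc], so the chain rule for these two
    projections covers all directions. *)
Lemma atom_is_derive p (i : 'I_4) a : M p ->
  is_derive p (ebasis R i) (atom_val^~ a) (ev p (Datom i a)).
Proof.
move=> [Up Vp].
have xyD (f : 'rV[R]_2 -> R) e0 e1 :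
    is_derive (xy p) (ebasis R 0) f (ev p e0) ->
    is_derive (xy p) (ebasis R 1) f (ev p e1) ->
    is_derive p (ebasis R i) (fun q => f (xy q))
     (ev p (match nat_of_ord i with 0%N => e0 | 1%N => e1 | _ => J0 end)).
  move=> fd0 fd1; case: i => [[|[|i]] Hi].
  - by apply: is_derive_xy fd0.
  - by apply: is_derive_xy fd1.
  - by case: i Hi => [|i] Hi; exact: is_derive_xy0.
have zD (f : R -> R) e : is_derive (zc p) 1 f (ev p e) ->
    is_derive p (ebasis R i) (fun q => f (zc q))
     (ev p (match nat_of_ord i with 2%N => e | _ => J0 end)).
  move=> fd; have := is_derive_zc i fd.
  by rewrite /=; case: (nat_of_ord i) => [|[|[|j]]].
have baseP (f : base_fun) s (b : bool) : is_derive (xy p) (ebasis R (if b then 1 else 0))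
    (pd_word s (base_val h l2 n2 f)) (ev p (Jv (Abase f (b :: s)))).
  by apply: DeriveDef => //; exact: smooth_on_derivable (smooth_base_word f s) Up.
have alphaP k : is_derive (zc p) 1 (derive1n k alpha) (ev p (jalpha k.+1)).
  by apply: DeriveDef; [exact: sa|rewrite /= derive1E].
case: a => [f s||k|||||].
- have := xyD _ _ _ (baseP f s false) (baseP f s true).
  by rewrite /Datom; case: (nat_of_ord i) => [|[|[|k]]].
- have hP b : is_derive (xy p) (ebasis R (if b then 1 else 0)) (fun q => (h q)^-1)
      (ev p (Datom_xy b Ahinv)).
    by apply: is_derive_inv; [rewrite gt_eqF // h0|exact: (baseP Fh [::] b)].
  have := xyD _ _ _ (hP false) (hP true).
  by rewrite /Datom; case: (nat_of_ord i) => [|[|[|k]]].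
- by move: (alphaP k) => /zD; rewrite /Datom; case: (nat_of_ord i) => [|[|[|j]]].
- have : is_derive (zc p) 1 (fun z => (alpha z)^-1) (ev p (Datom_z Aalphainv)).
    exact: is_derive_inv (a0 Vp) (alphaP 0%N).
  by move=> /zD; rewrite /Datom; case: (nat_of_ord i) => [|[|[|j]]].
- by move: (zD A (jalpha 0) (dA Vp)); rewrite /Datom; case: (nat_of_ord i) => [|[|[|j]]].
- have : is_derive (zc p) 1 (fun z => expR (A z)) (ev p (Datom_z AexpA)).
    by rewrite /= mulrC; apply: is_derive1_comp; exact: dA.
  by move=> /zD; rewrite /Datom; case: (nat_of_ord i) => [|[|[|j]]].
- have : is_derive (zc p) 1 (fun z => expR (- A z)) (ev p (Datom_z AexpNA)).
    rewrite /= -mulNr mulrC; apply: is_derive1_comp.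
    by apply: is_deriveN; exact: dA.
  by move=> /zD; rewrite /Datom; case: (nat_of_ord i) => [|[|[|j]]].
- have -> : ev p (Datom i Ahalf) = 0.
    by rewrite /Datom; case: (nat_of_ord i) => [|[|[|j]]].
  exact: is_derive_cst.
Qed.

Lemma ev_is_derive p (i : 'I_4) e : M p ->
  is_derive p (ebasis R i) (ev^~ e) (ev p (jD i e)).
Proof.
move=> Mp; elim: e => [||a|e1 IH1 e2 IH2|e1 IH1 e2 IH2|e1 IH1].
- exact: is_derive_cst.
- exact: is_derive_cst.
- exact: atom_is_derive.
- exact: is_deriveD.
- exact: is_deriveM.
- exact: is_deriveN.
Qed.

Lemma ev_continuous p e : M p -> {for p, continuous (ev^~ e)}.
Proof.
move=> Mp; elim: e => [||a|e1 IH1 e2 IH2|e1 IH1 e2 IH2|e1 IH1].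
- exact: cst_continuous.
- exact: cst_continuous.
- exact: atom_continuous.
- exact: continuousD.
- exact: continuousM.
- exact: continuousN.
Qed.

Lemma pd_ev p (i : 'I_4) e : M p -> pd i (ev^~ e) p = ev p (jD i e).
Proof. by move=> /(ev_is_derive i e)[]. Qed.

(** On [M] a partial derivative of an expression is again one, so the induction on the order runs
    over all expressions at once. *)
Lemma smooth_ev e : smooth_on M (ev^~ e).
Proof.
move=> k; elim: k e => [|k IH] e.
  by split=> // p; exact: ev_continuous.
split=> [p|i]; first exact: ev_continuous.
split=> [p Mp|]; first by have [] := ev_is_derive i e Mp.
apply: Ck_eq_on (IH (jD i e)); first exact: open_Mdom.
by move=> p Mp; exact: pd_ev.
Qed.

(** The bridge from analysis to formal computation: agreement on the open set [M] suffices, and only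
    there are [beta] and the inverses under control. *)
Lemma pd_eq_ev p (i : 'I_4) f e : M p -> (forall q, M q -> f q = ev q e) ->
  pd i f p = ev p (jD i e).
Proof.
move=> Mp fe; rewrite -pd_ev //; apply: pd_eq_on Mp fe; exact: open_Mdom.
Qed.

(** * Validity of the relations between atoms *)

Lemma curl_ev p : M p -> pd 0 n2 (xy p) = ev p (Jv (Abase Fl [:: true]) + jh * jh)%J.
Proof. by move=> [/curl Up _]; rewrite /= -expr2 -Up addrC subrK. Qed.

Lemma jet_relsP p : M p -> forall r, List.In r jet_rels -> ev p r.1 = ev p r.2.
Proof.
move=> Mp; have [Up Vp] := Mp.
(* Lifting to four coordinates makes [pd_eq_ev] applicable. *)
have Ename (f : 'rV[R]_2 -> R) (j : 'I_2) (i : 'I_4) : val j = val i ->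
    pd j f (xy p) = pd i (fun q => f (xy q)) p.
  by move=> ji; rewrite /pd derive_xy_eq (xy_ebasis R ji).
(* The curl equation holds on an open set and may be differentiated. *)
have Dn (j : 'I_2) (i : 'I_4) : val j = val i -> pd j (pd 0 n2) (xy p)
    = ev p (jD i (Jv (Abase Fl [:: true]) + jh * jh)%J).
  by move=> ji; rewrite (Ename _ _ _ ji); apply: pd_eq_ev => // q; exact: curl_ev.
have two (x y : R) : x * y + x * y = (1 + 1) * (x * y) by rewrite mulrDl mul1r.
have nyx : pd 1 (pd 0 n2) (xy p) =
    ev p (Jv (Abase Fl [:: true; true]) + (1 + 1) * (jh * Jv (Abase Fh [:: true])))%J.
  by apply: etrans (Dn 1 iy erefl) _; congr (_ + _); exact: two.
move=> r [<-|[<-|[<-|[<-|[<-|[<-|[<-|[<-|[<-|[<-|[]]]]]]]]]]].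
- exact: (pd_comm 1 0 oU sh Up).
- exact: (pd_comm 1 0 oU sl Up).
- exact: curl_ev.
- by apply: etrans (Dn 0 ix erefl) _; congr (_ + _); exact: two.
- exact: nyx.
- exact: etrans (pd_comm 0 1 oU sn Up) nyx.
- by apply: mulfV; rewrite gt_eqF // h0.
- by apply: mulfV; exact: a0.
- by rewrite /= -expRD subrr expR0.
- by apply: (@mulfV R 2); rewrite pnatr_eq0.
Qed.

Lemma jcheck_eq p e1 e2 : M p -> jcheck e1 e2 -> ev p e1 = ev p e2.
Proof. by move=> /jet_relsP; exact: jcheckP. Qed.

Lemma jcheck2_eq F G p (i j : 'I_4) : jcheck2 F G -> M p ->
  ev p (F i j) = ev p (G i j).
Proof.
have i4 (k : 'I_4) : nat_of_ord k \in iota 0 4 by rewrite mem_iota ltn_ord.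
rewrite /jcheck2 => /allP FG Mp; apply: jcheck_eq Mp _.
exact: (allP (FG _ (i4 i)) _ (i4 j)).
Qed.

Lemma jcheck3_eq F G p (i j k : 'I_4) : jcheck3 F G -> M p ->
  ev p (F i j k) = ev p (G i j k).
Proof.
rewrite /jcheck3 => /allP FG Mp; apply: (jcheck2_eq (F := F i) (G := G i)) Mp.
by apply: FG; rewrite mem_iota ltn_ord.
Qed.

(** * Metric, forms and curvature as values of formal expressions *)

Local Notation g := (gmetric h l2 n2 A beta).

Lemma sum4_ev p F : \sum_(l < 4) ev p (F (nat_of_ord l)) = ev p (jsum4 F).
Proof. by rewrite !big_ord_recl big_ord0 addr0. Qed.

Lemma evD p e1 e2 : ev p (e1 + e2)%J = ev p e1 + ev p e2.
Proof. by []. Qed.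

Lemma evM p e1 e2 : ev p (e1 * e2)%J = ev p e1 * ev p e2.
Proof. by []. Qed.

Lemma ebasis_ev p (i j : 'I_4) : ebasis R i 0 j = ev p (jdelta i j).
Proof. by rewrite /jdelta mxE eqxx /= -val_eqE eq_sym; case: eqP. Qed.

Lemma betaE z : V z -> beta z = expR (A z) * (alpha z)^-1.
Proof. by move=> Vz; rewrite -(ba Vz) mulfK // a0. Qed.

Lemma betaVE z : V z -> (beta z)^-1 = alpha z * expR (- A z).
Proof. by move=> Vz; rewrite betaE // invfM invrK expRN mulrC. Qed.

Lemma theta3_ev p (i : 'I_4) : M p -> theta3 l2 n2 beta p 0 i = ev p (jtheta3 i).
Proof.
move=> [_ Vp].
have E (u v w : 'rV[R]_4) (c a b : R) :
    (c *: (u - a *: v - b *: w)) 0 i = c * (u 0 i - a * v 0 i - b * w 0 i).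
  by rewrite !mxE.
by rewrite /theta3 E betaVE // !(ebasis_ev p).
Qed.

Lemma tensor_row (u v : 'rV[R]_4) i j : (u^T *m v) i j = u 0 i * v 0 j.
Proof. by rewrite mxE big_ord1 mxE. Qed.

Lemma wedge11E (u v : 'rV[R]_4) i j :
  wedge11 u v i j = u 0 i * v 0 j - v 0 i * u 0 j.
Proof. by rewrite -!tensor_row !mxE. Qed.

Lemma gmetric_ev p (i j : 'I_4) : M p -> g p i j = ev p (jg i j).
Proof.
move=> Mp.
have E (X Y Z W : 'M[R]_4) (a b : R) : (a *: (b *: (X + Y)) + Z + W) i j
    = a * (b * (X i j + Y i j)) + Z i j + W i j by rewrite !mxE.
rewrite /gmetric /gSigma E !tensor_row !theta3_ev // !(ebasis_ev p).
by rewrite expr2.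
Qed.

Lemma Omega_ev p (i j : 'I_4) : M p ->
  Omega h l2 n2 A beta p i j = ev p (jOmega true i j).
Proof.
move=> Mp.
have E (X Y : 'M[R]_4) (a b : R) : (a *: (b *: X) + Y) i j = a * (b * X i j) + Y i j.
  by rewrite !mxE.
by rewrite /Omega /omSigma E !wedge11E !theta3_ev // !(ebasis_ev p) expr2.
Qed.

Lemma Omega_bar_ev p (i j : 'I_4) : M p ->
  Omega_bar h l2 n2 A beta p i j = ev p (jOmega false i j).
Proof.
move=> Mp.
have E (X Y : 'M[R]_4) (a b : R) : (a *: (b *: X) + Y) i j = a * (b * X i j) + Y i j.
  by rewrite !mxE.
rewrite /Omega_bar /omSigma E !wedge11E !theta3_ev // !(ebasis_ev p) expr2.
by congr (_ + _); rewrite [RHS]opprB.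
Qed.

Definition Jmx s (p : 'rV[R]_4) : 'M[R]_4 :=
  \matrix_(i < 4, j < 4) ev p (jJ s i j).

Lemma mulmx_ev p (X Y : 'M[R]_4) (F G : nat -> nat -> jet) :
  (forall i j : 'I_4, X i j = ev p (F i j)) ->
  (forall i j : 'I_4, Y i j = ev p (G i j)) ->
  forall i j : 'I_4, (X *m Y) i j = ev p (jmulmx F G i j).
Proof.
move=> XF YG i j; rewrite mxE /jmulmx -sum4_ev.
by apply: eq_bigr => k _; rewrite XF YG.
Qed.

Lemma trmx_ev p (X : 'M[R]_4) (F : nat -> nat -> jet) :
  (forall i j : 'I_4, X i j = ev p (F i j)) ->
  forall i j : 'I_4, X^T i j = ev p (F j i).
Proof. by move=> XF i j; rewrite mxE. Qed.

Lemma Jmx_ev s p (i j : 'I_4) : Jmx s p i j = ev p (jJ s i j).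
Proof. by rewrite mxE. Qed.

Lemma comp_Jmx s (i j : 'I_4) : Defs.comp (Jmx s) i j = ev^~ (jJ s i j).
Proof. by apply/funext=> p; rewrite /Defs.comp mxE. Qed.

(** A one-sided inverse of a square matrix is two-sided, so [jginv_check] determines [invmx]. *)
Lemma invmx_gmetric_ev p (i j : 'I_4) : M p -> invmx (g p) i j = ev p (jginv i j).
Proof.
move=> Mp; pose B : 'M[R]_4 := \matrix_(i < 4, j < 4) ev p (jginv i j).
have B_ev (a b : 'I_4) : B a b = ev p (jginv a b) by rewrite mxE.
have gB : g p *m B = 1%:M.
  apply/matrixP=> a b; rewrite (mulmx_ev (fun c e => gmetric_ev c e Mp) B_ev).
  by rewrite (jcheck2_eq _ _ jginv_check Mp) -ebasis_ev !mxE eqxx eq_sym.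
have [gu _] := mulmx1_unit gB.
have -> : invmx (g p) = B by rewrite -[B]mul1mx -(mulVmx gu) -mulmxA gB mulmx1.
exact: B_ev.
Qed.

Lemma christ_ev p (k i j : 'I_4) : M p -> christ g p k i j = ev p (jchrist k i j).
Proof.
move=> Mp; rewrite /christ /jchrist evM -sum4_ev; congr (_ * _).
apply: eq_bigr => l _; rewrite invmx_gmetric_ev //; congr (_ * _).
have gD (a b c : 'I_4) : pd a (Defs.comp g b c) p = ev p (jD a (jg b c)).
  by apply: pd_eq_ev Mp _ => q; exact: gmetric_ev.
by rewrite !gD.
Qed.

Lemma ricci_ev p (j k : 'I_4) : M p -> ricci g p j k = ev p (jricci_diag j k).
Proof.
move=> Mp; rewrite -(jcheck2_eq _ _ jricci_check Mp).
rewrite mxE /jricci -sum4_ev; apply: eq_bigr => i _.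
have cD (a b c e : 'I_4) : pd a (fun q => christ g q b c e) p = ev p (jD a (jchrist b c e)).
  by apply: pd_eq_ev Mp _ => q; exact: christ_ev.
rewrite !cD evD -sum4_ev; congr (_ + _).
by apply: eq_bigr => m _; rewrite !christ_ev.
Qed.

(** * Hermitian, Kaehler and locally conformally Kaehler structures; Lee form *)

Lemma kform_ev s p (i j : 'I_4) : M p -> kform g (Jmx s) p i j = ev p (jOmega s i j).
Proof.
move=> Mp; rewrite /kform (mulmx_ev (Jmx_ev s p) (fun c e => gmetric_ev c e Mp)).
exact: jcheck2_eq (jOmega_check s) Mp.
Qed.

Lemma kform_Jmx_bar p : M p -> kform g (Jmx false) p = Omega_bar h l2 n2 A beta p.
Proof. by move=> Mp; apply/matrixP=> i j; rewrite kform_ev // Omega_bar_ev. Qed.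

Lemma kform_Jmx p : M p -> kform g (Jmx true) p = Omega h l2 n2 A beta p.
Proof. by move=> Mp; apply/matrixP=> i j; rewrite kform_ev // Omega_ev. Qed.

Lemma nijenhuis_Jmx s p (i j a : 'I_4) : M p -> nijenhuis (Jmx s) p i j a = 0.
Proof.
move=> Mp; apply: etrans (jcheck3_eq i j a (jnijenhuis_check s) Mp).
rewrite /nijenhuis /jnijenhuis -sum4_ev; apply: eq_bigr => b _.
by rewrite !comp_Jmx !pd_ev // !Jmx_ev.
Qed.

Lemma hermitian_Jmx s : hermitian_str M g (Jmx s).
Proof.
split; last by move=> p Mp i j a; exact: nijenhuis_Jmx.
split=> [i j|p Mp]; first by rewrite comp_Jmx; exact: smooth_ev.
split; apply/matrixP=> i j.
  rewrite (mulmx_ev (Jmx_ev s p) (Jmx_ev s p)).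
  rewrite (jcheck2_eq _ _ (jJ2_check s) Mp) [LHS]/= -ebasis_ev.
  by rewrite !mxE eqxx eq_sym.
(* The left factor J g is [kform], already identified with [jOmega]. *)
rewrite (mulmx_ev (G := fun a b => jJ s b a)
  (fun a b => kform_ev s a b Mp) (trmx_ev (Jmx_ev s p))).
by rewrite gmetric_ev //; exact: jcheck2_eq (jJorth_check s) Mp.
Qed.

Lemma d2form_ev (F : 'rV[R]_4 -> 'M[R]_4) (G : nat -> nat -> jet) p (i j k : 'I_4) :
  (forall q (a b : 'I_4), M q -> F q a b = ev q (G a b)) -> M p ->
  d2form F p i j k = ev p (jd2form G i j k).
Proof.
move=> FG Mp.
have FD (a b c : 'I_4) : pd a (Defs.comp F b c) p = ev p (jD a (G b c)).
  by apply: pd_eq_ev Mp _ => q Mq; exact: FG.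
by rewrite /d2form !FD.
Qed.

Lemma kaehler_Jmx_bar : kaehler_str M g (Jmx false).
Proof.
split; first exact: hermitian_Jmx.
move=> p Mp i j k; rewrite (d2form_ev i j k (kform_ev false) Mp).
exact: jcheck3_eq jOmega_bar_closed_check Mp.
Qed.

Lemma lck_Jmx : lck M g (Jmx true).
Proof.
move=> p Mp; exists M; split=> //; first exact: open_Mdom.
(* The conformal factor is exp(2A), available on all of [M], so one neighbourhood serves every
   point. *)
exists (ev^~ (Jv AA + Jv AA)%J); split; first exact: smooth_ev.
have [[sJ JJ] nJ] := hermitian_Jmx true.
split; first split; [split; first exact: sJ| exact: nJ|].
  move=> q Mq; have [JJ1 JgJ] := JJ q Mq; split; first exact: JJ1.
  by rewrite -scalemxAr -scalemxAl JgJ.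
move=> q Mq i j k.
apply: etrans (jcheck3_eq i j k jOmega_conf_closed_check Mq).
apply: d2form_ev Mq => q' a b Mq'.
rewrite /kform -scalemxAr mxE -/(kform g (Jmx true) q') kform_ev //.
by rewrite [ev q' (_ + _)%J]/= expRD.
Qed.

Lemma lee_form p (i j k : 'I_4) : M p ->
  d2form (kform g (Jmx true)) p i j k
  = 2 * wedge12 (- alpha (zc p) *: theta4 R) (kform g (Jmx true) p) i j k.
Proof.
move=> Mp; rewrite (d2form_ev i j k (kform_ev true) Mp).
have E (c : R) (u : 'rV[R]_4) (a : 'I_4) : (c *: u) 0 a = c * u 0 a by rewrite mxE.
rewrite /wedge12 !kform_ev // !E !(ebasis_ev p).
exact: jcheck3_eq jLee_check Mp.
Qed.

Lemma ricci_J_inv_Jmx : ricci_J_inv M g (Jmx true).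
Proof.
move=> p Mp; apply/matrixP=> i j.
rewrite (mulmx_ev (G := fun a b => jJ true b a)
  (mulmx_ev (Jmx_ev true p) (fun a b => ricci_ev a b Mp))
  (trmx_ev (Jmx_ev true p))) ricci_ev //.
exact: jcheck2_eq jricci_inv_check Mp.
Qed.

(** * Scalar curvature *)

Lemma lap_ln_h_ev p : M p -> lap2 (fun q => ln (h q)) (xy p) = ev p jlap_ln_h.
Proof.
move=> Mp.
have lift (f : 'rV[R]_2 -> R) (j : 'I_2) (i : 'I_4) : val j = val i ->
    pd j f (xy p) = pd i (fun q => f (xy q)) p.
  by move=> ji; rewrite /pd derive_xy_eq (xy_ebasis R ji).
(* [ln h] is not a formal expression, but its first partials h_x / h and h_y / h are; only the outer
   derivative is taken formally. *)
rewrite /lap2 /jlap_ln_h evD; congr (_ + _).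
  rewrite (lift _ 0 ix erefl); apply: (pd_eq_ev ix Mp) => q [Uq _].
  exact: (pd_ln 0 sh Uq (h0 Uq)).
rewrite (lift _ 1 iy erefl); apply: (pd_eq_ev iy Mp) => q [Uq _].
exact: (pd_ln 1 sh Uq (h0 Uq)).
Qed.

(** Serves twice for [beta], whose expression is known on [V] only; reading [f] as a function on [M]
    lets [pd_eq_ev] apply. *)
Lemma derive1_ev f e p : (forall q, M q -> f (zc q) = ev q e) -> M p ->
  derive1 f (zc p) = ev p (jD 2 e).
Proof.
move=> fe Mp; rewrite -(pd_eq_ev iz Mp fe) derive1E.
by rewrite /pd derive_zc_eq zc_ebasis.
Qed.

Lemma scal_ev p : M p -> scal g p =
  2 * (- (lap2 (fun q => ln (h q)) (xy p)) * expR (A (zc p)) / h (xy p) ^+ 2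
       - 2 * alpha (zc p) ^+ 2 + 2 * derive1 alpha (zc p)
       + derive1 (derive1 beta) (zc p) / beta (zc p)
       - 2 * (derive1 beta (zc p) / beta (zc p)) ^+ 2).
Proof.
move=> Mp; have [Up Vp] := Mp.
have beta_ev q : M q -> beta (zc q) = ev q jbeta by move=> [_ Vq]; exact: betaE.
have dbeta q : M q -> derive1 beta (zc q) = ev q (jD 2 jbeta) by exact: derive1_ev.
have ddbeta : derive1 (derive1 beta) (zc p) = ev p (jD 2 (jD 2 jbeta)).
  exact: derive1_ev Mp.
have -> : scal g p = ev p (jsum4 (fun j => jsum4 (fun k => jginv j k * jricci_diag j k)%J)).
  rewrite /scal -sum4_ev; apply: eq_bigr => j _; rewrite -sum4_ev.
  by apply: eq_bigr => k _; rewrite invmx_gmetric_ev // ricci_ev.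
rewrite (jcheck_eq Mp jscal_check).
by rewrite lap_ln_h_ev // dbeta // ddbeta betaVE // expr2 invfM !expr2.
Qed.

End Geometry.

Theorem theorem1 (R : realType) (U : set 'rV[R]_2) (V : set R)
  (h l2 n2 : 'rV[R]_2 -> R) (alpha A beta : R -> R) :
  open U -> smooth_on U h -> (forall q, U q -> 0 < h q) ->
  open V -> smooth1_on V alpha -> (forall z, V z -> alpha z != 0) ->
  (forall z, V z -> is_derive z 1 A (alpha z)) ->
  (forall z, V z -> beta z * alpha z = expR (A z)) ->
  smooth_on U l2 -> smooth_on U n2 ->
  (forall q, U q -> pd 0 n2 q - pd 1 l2 q = h q ^+ 2) ->
  let M := Mdom U V in
  let g := gmetric h l2 n2 A beta in
  (exists Jb : 'rV[R]_4 -> 'M[R]_4,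
     kaehler_str M g Jb /\ forall p, M p -> kform g Jb p = Omega_bar h l2 n2 A beta p) /\
  (exists J : 'rV[R]_4 -> 'M[R]_4,
     [/\ hermitian_str M g J, forall p, M p -> kform g J p = Omega h l2 n2 A beta p,
         ricci_J_inv M g J, lck M g J &
         forall p, M p -> forall i j k : 'I_4,
           d2form (kform g J) p i j k
           = 2 * wedge12 (- alpha (zc p) *: theta4 R) (kform g J p) i j k]) /\
  (forall p, M p ->
     scal g p =
       2 * (- (lap2 (fun q => ln (h q)) (xy p)) * expR (A (zc p)) / h (xy p) ^+ 2
            - 2 * alpha (zc p) ^+ 2 + 2 * derive1 alpha (zc p)
            + derive1 (derive1 beta) (zc p) / beta (zc p)
            - 2 * (derive1 beta (zc p) / beta (zc p)) ^+ 2)).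
Proof.
move=> oU sh h0 oV sa a0 dA ba sl sn curl M g; split; [|split].
- exists (Jmx h l2 n2 alpha A false); split.
    by eapply kaehler_Jmx_bar; eassumption.
  by move=> p Mp; eapply kform_Jmx_bar; eassumption.
- exists (Jmx h l2 n2 alpha A true); split.
  + by eapply hermitian_Jmx; eassumption.
  + by move=> p Mp; eapply kform_Jmx; eassumption.
  + by eapply ricci_J_inv_Jmx; eassumption.
  + by eapply lck_Jmx; eassumption.
  + by move=> p Mp i j k; eapply lee_form; eassumption.
- by move=> p Mp; eapply scal_ev; eassumption.
Qed.
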